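(* Let $A\in\mathbb R^{m\times n}$ and let $\beta^1,\dots,\beta^k\in\mathbb R^n$ be linearly independent, and assume that the polyhedra $P$ and $Q'^k$ (defined in the context) are non-degenerate. Let $\Gamma^k=\{(A,-A+\sum_{l=1}^k\alpha^l\beta^{l\,T}):\alpha^l\in\mathbb R^m\ \forall l\le k\}$, let $G(\alpha)$ denote the game with parameter $\alpha=(\alpha^1,\dots,\alpha^k)\in\mathbb R^{km}$, and let $$E_{\Gamma^k}=\{(\alpha,x,y)\in\mathbb R^{km}\times\Delta_1\times\Delta_2:(x,y)\text{ is a Nash equilibrium of }G(\alpha)\}.$$ Then the Nash equilibrium correspondence $E_{\Gamma^k}$ is homeomorphic to the game space $\Gamma^k$ (where $\Gamma^k\cong\mathbb R^{km}$ via the parameter $\alpha$).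
   Context: Let $S_1=\{1,\dots,m\}$, $S_2=\{1,\dots,n\}$, and let $\Delta_1\subset\mathbb R^m$, $\Delta_2\subset\mathbb R^n$ be the standard probability simplices. For a matrix $M$, $M_i$ is its $i$-th row and $M^j$ its $j$-th column. A Nash equilibrium of a bimatrix game $(A,B)$ is $(x,y)\in\Delta_1\times\Delta_2$ with $x^TAy\ge x'^TAy$ for all $x'\in\Delta_1$ and $x^TBy\ge x^TBy'$ for all $y'\in\Delta_2$. $P=\{(y,\pi_1)\in\mathbb R^{n+1}: A_iy-\pi_1\le0\ (i\in S_1);\ y_j\ge0\ (j\in S_2);\ \sum_j y_j=1\}$ (of dimension $n$). $Q'^k=\{(x,\lambda,\pi_2)\in\mathbb R^{m}\times\mathbb R^k\times\mathbb R: x_i\ge0\ (i\in S_1);\ -x^TA^j+\sum_{l=1}^k\beta^l_j\lambda_l-\pi_2\le0\ (j\in S_2);\ \sum_i x_i=1\}$ (of dimension $m+k$). Non-degeneracy: every point in the relative interior of a $d$-dimensional face of $P$ (resp. $Q'^k$) has exactly $n-d$ (resp. $m+k-d$) of the listed inequalities tight. All sets carry the Euclidean subspace topology. *)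

(* Defs.v *)
From HB Require Import structures.
From mathcomp Require Import all_boot all_order all_algebra.
From mathcomp Require Import all_classical all_reals all_analysis.
Import Order.TTheory GRing.Theory Num.Theory.
Import numFieldNormedType.Exports.

Set Implicit Arguments.
Unset Strict Implicit.
Unset Printing Implicit Defensive.

Local Open Scope classical_set_scope.
Local Open Scope ring_scope.

(** Vectors of R^N are column vectors; matrix types carry the product
    (= Euclidean) topology. *)

(** ** Homeomorphisms between subspaces *)

(** [{within A, continuous f}] is continuity on [A] for the subspace topology;
    the values of [f] outside [A] and of [g] outside [B] are irrelevant. *)
Definition homeomorphism_between (T U : topologicalType)
    (A : set T) (B : set U) (f : T -> U) (g : U -> T) : Prop :=
  [/\ (forall x, A x -> B (f x)) /\ (forall y, B y -> A (g y)),
      (forall x, A x -> g (f x) = x) /\ (forall y, B y -> f (g y) = y),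
      {within A, continuous f} & {within B, continuous g}].

Definition homeomorphic (T U : topologicalType) (A : set T) (B : set U) : Prop :=
  exists f : T -> U, exists g : U -> T, homeomorphism_between A B f g.

(** ** Faces, dimension, relative interior *)

Definition affine_hull (R : realType) (N : nat) (F : set 'cV[R]_N) :
    set 'cV[R]_N :=
  [set v | exists (r : nat) (w : 'I_r -> R) (p : 'I_r -> 'cV[R]_N),
     [/\ forall i, F (p i), \sum_(i < r) w i = 1 &
         v = \sum_(i < r) w i *: p i]].

(** Never holds of the empty set. *)
Definition has_dim (R : realType) (N : nat) (F : set 'cV[R]_N) (d : nat) : Prop :=
  exists (v0 : 'cV[R]_N) (U : {vspace 'cV[R]_N}),
    \dim U = d /\ affine_hull F = [set v0 + u | u in [set u | u \in U]].

Definition rel_interior (R : realType) (N : nat) (F : set 'cV[R]_N) :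
    set 'cV[R]_N :=
  [set v | F v /\ within (affine_hull F) (nbhs v) F].

(** Faces are cut out by valid inequalities [c^T v <= delta]; [c = 0] gives
    [C] itself (and the empty face). *)
Definition is_face (R : realType) (N : nat) (C F : set 'cV[R]_N) : Prop :=
  exists (c : 'cV[R]_N) (delta : R),
    (forall v, C v -> (c^T *m v) 0 0 <= delta) /\
    F = C `&` [set v | (c^T *m v) 0 0 = delta].

(** [g i v <= 0] for [i : I] are the listed inequalities of the polyhedron [C],
    and [D] is its dimension.  The count [D - d] is written additively, to
    avoid truncated subtraction. *)
Definition nondegenerate_polyhedron (R : realType) (N : nat) (I : finType)
    (g : I -> 'cV[R]_N -> R) (C : set 'cV[R]_N) (D : nat) : Prop :=
  forall (F : set 'cV[R]_N) (d : nat) (v : 'cV[R]_N),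
    is_face C F -> has_dim F d -> rel_interior F v ->
    (#|[pred i : I | g i v == 0%R]| + d = D)%N.

(** ** The polyhedra [P] and [Q'^k] *)

(** A point of R^(n+1) is the stacked column (y, pi1). *)
Definition P_ineq (R : realType) (m n : nat) (A : 'M[R]_(m, n))
    (i : 'I_m + 'I_n) (v : 'cV[R]_(n + 1)) : R :=
  let y := usubmx v in
  let pi1 := dsubmx v 0 0 in
  match i with
  | inl i => (A *m y) i 0 - pi1
  | inr j => - y j 0
  end.

Definition P (R : realType) (m n : nat) (A : 'M[R]_(m, n)) :
    set 'cV[R]_(n + 1) :=
  [set v | (forall i, P_ineq A i v <= 0) /\ \sum_(j < n) usubmx v j 0 = 1].

(** A point of R^(m+k+1) is the stacked column (x, lambda, pi2); [tnth beta l]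
    is the vector beta^l. *)
Definition Q_ineq (R : realType) (m n k : nat) (A : 'M[R]_(m, n))
    (beta : k.-tuple 'cV[R]_n) (i : 'I_m + 'I_n) (v : 'cV[R]_(m + k + 1)) : R :=
  let x := usubmx (usubmx v) in
  let lambda := dsubmx (usubmx v) in
  let pi2 := dsubmx v 0 0 in
  match i with
  | inl i => - x i 0
  | inr j => - (x^T *m A) 0 j + \sum_(l < k) tnth beta l j 0 * lambda l 0 - pi2
  end.

Definition Q (R : realType) (m n k : nat) (A : 'M[R]_(m, n))
    (beta : k.-tuple 'cV[R]_n) : set 'cV[R]_(m + k + 1) :=
  [set v | (forall i, Q_ineq A beta i v <= 0) /\
           \sum_(i < m) usubmx (usubmx v) i 0 = 1].

(** ** Bimatrix games and their Nash equilibria *)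

Definition simplex (R : realType) (N : nat) : set 'cV[R]_N :=
  [set x | (forall i, 0 <= x i 0) /\ \sum_(i < N) x i 0 = 1].
Arguments simplex : clear implicits.

Definition payoff (R : realType) (m n : nat) (M : 'M[R]_(m, n))
    (x : 'cV[R]_m) (y : 'cV[R]_n) : R := (x^T *m M *m y) 0 0.

Definition nash (R : realType) (m n : nat) (G : 'M[R]_(m, n) * 'M[R]_(m, n))
    (x : 'cV[R]_m) (y : 'cV[R]_n) : Prop :=
  [/\ simplex R m x, simplex R n y,
      forall x', simplex R m x' -> payoff G.1 x' y <= payoff G.1 x y &
      forall y', simplex R n y' -> payoff G.2 x y' <= payoff G.2 x y].

(** The parameter (alpha^1, ..., alpha^k) is the matrix with columns alpha^l. *)
Definition game (R : realType) (m n k : nat) (A : 'M[R]_(m, n))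
    (beta : k.-tuple 'cV[R]_n) (alpha : 'M[R]_(m, k)) :
    'M[R]_(m, n) * 'M[R]_(m, n) :=
  (A, - A + \sum_(l < k) col l alpha *m (tnth beta l)^T).

Definition game_space (R : realType) (m n k : nat) (A : 'M[R]_(m, n))
    (beta : k.-tuple 'cV[R]_n) : set ('M[R]_(m, n) * 'M[R]_(m, n)) :=
  range (game A beta).

Definition nash_correspondence (R : realType) (m n k : nat) (A : 'M[R]_(m, n))
    (beta : k.-tuple 'cV[R]_n) : set ('M[R]_(m, k) * 'cV[R]_m * 'cV[R]_n) :=
  [set t | let: (alpha, x, y) := t in nash (game A beta alpha) x y].

(* Main.v *)
Require Import Defs.
From HB Require Import structures.
From mathcomp Require Import all_boot all_order all_algebra.
From mathcomp Require Import all_classical all_reals all_analysis.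
From mathcomp Require Import ring lra.
Import Order.TTheory GRing.Theory Num.Theory.
Import numFieldNormedType.Exports.

Set Implicit Arguments.
Unset Strict Implicit.
Unset Printing Implicit Defensive.

Local Open Scope classical_set_scope.
Local Open Scope ring_scope.

(** Write B for the matrix with columns beta^l and lam = x^T alpha.  Then (x, y)
    is an equilibrium of G(alpha) iff it is a saddle point of the zero-sum game
    x^T A y - lam.(B^T y), so alpha matters only through lam.  The coordinate
    z = lam + B^T y determines everything: the correspondence lam |-> B^T y is
    monotone, so z determines lam and B^T y; and for fixed lam and B^T y, x and
    y are multipliers of the constraints tight at a point of P and of Q'^k
    respectively, hence unique by non-degeneracy.  Each z in R^k is attained, by minimising
    max_i (A y)_i + |z - B^T y|^2 / 2, and (x, y) is continuous in z by
    compactness of the simplices and uniqueness.  Finally alpha is recovered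
    from z and from the differences between the rows of alpha. *)

(** * Continuity of maps into matrices and products *)

Section MatrixContinuity.
Variables (R : realType) (T : topologicalType).

Lemma continuous_mx (m n : nat) (f : T -> 'M[R]_(m, n)) :
  (forall i j, continuous (fun t => f t i j)) -> continuous f.
Proof.
move=> fc t S [/= B nB BS].
have : \forall s \near t, forall i j, B i j (f s i j).
  apply: (@filter_forall _ _ (fun i s => forall j, B i j (f s i j))) => i.
  apply: (@filter_forall _ _ (fun j s => B i j (f s i j))) => j.
  exact: fc (nB i j).
by apply: filterS => s; apply: BS.
Qed.

Lemma continuous_coord (m n : nat) (f : T -> 'M[R]_(m, n)) i j :
  continuous f -> continuous (fun t => f t i j).
Proof.
move=> fc t.
apply: (@cvg_comp _ _ _ f (fun N : 'M[R]_(m, n) => N i j)) (fc t) _.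
exact: coord_continuous.
Qed.

Lemma continuous_addf (V : normedModType R) (f g : T -> V) :
  continuous f -> continuous g -> continuous (fun t => f t + g t).
Proof. by move=> fc gc t; exact: cvgD (fc t) (gc t). Qed.

Lemma continuous_subf (V : normedModType R) (f g : T -> V) :
  continuous f -> continuous g -> continuous (fun t => f t - g t).
Proof. by move=> fc gc t; exact: cvgB (fc t) (gc t). Qed.

Lemma continuous_mulf (f g : T -> R) :
  continuous f -> continuous g -> continuous (fun t => f t * g t).
Proof. by move=> fc gc t; exact: cvgM (fc t) (gc t). Qed.

Lemma continuous_mulmx (m n p : nat) (f : T -> 'M[R]_(m, n))
    (g : T -> 'M[R]_(n, p)) :
  continuous f -> continuous g -> continuous (fun t => f t *m g t).
Proof.
move=> fc gc; apply: continuous_mx => i j; under eq_fun do rewrite mxE.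
apply: (continuous_big add_continuous) => l _.
by apply: continuous_mulf; apply: continuous_coord.
Qed.

Lemma continuous_trmx (m n : nat) (f : T -> 'M[R]_(m, n)) :
  continuous f -> continuous (fun t => (f t)^T).
Proof.
move=> fc; apply: continuous_mx => i j; under eq_fun do rewrite mxE.
exact: continuous_coord.
Qed.

Lemma continuous_bigmax (I : Type) (r : seq I) (f0 : T -> R) (f : I -> T -> R) :
  continuous f0 -> (forall i, continuous (f i)) ->
  continuous (fun t => \big[Num.max/f0 t]_(i <- r) f i t).
Proof.
move=> cf0 cf; elim: r => [|i r IH].
  by under eq_fun do rewrite big_nil.
under eq_fun do rewrite big_cons.
by move=> t; exact: (continuous_max (cf i t) (IH t)).
Qed.

End MatrixContinuity.

Lemma id_continuous (T : topologicalType) : continuous (fun t : T => t).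
Proof. by move=> t; exact: cvg_id. Qed.

Section ProductContinuity.
Variables T U V : topologicalType.

Lemma continuous_fst (f : T -> U * V) :
  continuous f -> continuous (fun t => (f t).1).
Proof. by move=> fc t; apply: (cvg_comp _ _ (fc t)); exact: cvg_fst. Qed.

Lemma continuous_snd (f : T -> U * V) :
  continuous f -> continuous (fun t => (f t).2).
Proof. by move=> fc t; apply: (cvg_comp _ _ (fc t)); exact: cvg_snd. Qed.

Lemma continuous_pair (f : T -> U) (g : T -> V) :
  continuous f -> continuous g -> continuous (fun t => (f t, g t)).
Proof. by move=> fc gc t; exact: cvg_pair (fc t) (gc t). Qed.

Lemma continuous_compf (f : T -> U) (g : U -> V) :
  continuous f -> continuous g -> continuous (fun t => g (f t)).
Proof. by move=> fc gc t; exact: (cvg_comp _ _ (fc t)) (gc _). Qed.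

End ProductContinuity.

(** * Cluster points and convergence *)

(** If a neighbourhood [U] of [x] were not in [F], the trace of [F] on the complement of [U] would
    be a proper filter containing [K]. Its cluster point in [K] also clusters [F], hence is [x],
    although [U] misses the trace. *)
Lemma compact_unique_cluster_cvg (T : topologicalType) (K : set T)
    (F : set_system T) (x : T) {FF : ProperFilter F} :
  compact K -> F K -> (forall y, K y -> cluster F y -> y = x) -> F --> x.
Proof.
move=> cK FK clx U Ux; apply: contrapT => nFU.
have FW : ProperFilter (within (~` U) F).
  apply: Build_ProperFilter_ex => B FB; apply: contrapT => nB.
  apply: nFU; apply: (filterS (F := F) _ FB) => t Bt; apply: contrapT => nUt.
  by apply: nB; exists t; apply: Bt.
have sF B : F B -> within (~` U) F B.
  by move=> FB; apply: (filterS (F := F) _ FB) => t Bt _.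
have [y [Ky cly]] := cK _ FW (sF _ FK).
have yx : y = x.
  by apply: clx => // B C FB; apply: cly; apply: sF.
subst y; have [t [nUt Ut]] := cly (~` U) U (withinT _ FF) Ux.
exact: nUt.
Qed.

(** If [phi] were negative at [(z, p)], it would be so on a product neighbourhood, which the
    clustering makes some [(w, s w)] enter. This passes non-strict inequalities to cluster points of
    [s] before [s] is known to be continuous. *)
Lemma cluster_ge0 (R : realType) (S T : topologicalType) (phi : S * T -> R)
    (s : S -> T) (z : S) (p : T) :
  {for (z, p), continuous phi} -> (forall w, 0 <= phi (w, s w)) ->
  cluster (s w @[w --> z]) p -> 0 <= phi (z, p).
Proof.
move=> phic phi0 clp; rewrite leNgt; apply/negP => phi_lt0.
have /phic[[U V] /= [Uz Vp] UV] : nbhs (phi (z, p)) [set r | r < 0].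
  exact: lt_nbhsl.
have [||t [[w Uw <-] Vt]] := clp [set s w | w in U] V.
- by apply: filterS Uz => w Uw; exists w.
- by [].
by have := UV (w, s w) (conj Uw Vt); rewrite /= ltNge phi0.
Qed.

(** * Non-degeneracy and uniqueness of multipliers *)

Lemma linear_functionalE (R : realType) (N : nat) (h : 'cV[R]_N -> R) :
  linear (h : _ -> R^o) ->
  forall v, h v = \sum_(j < N) v j 0 * h (delta_mx j 0).
Proof.
move=> hlin; pose H : {linear 'cV[R]_N -> R^o} :=
  HB.pack h (GRing.isLinear.Build _ _ _ _ h hlin).
move=> v; rewrite -[h v]/(H v) {1}[v]matrix_sum_delta raddf_sum.
apply: eq_bigr => j _; rewrite big_ord1. exact: (linearZ_LR H).
Qed.

Lemma linear_functional_continuous (R : realType) (N : nat)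
    (h : 'cV[R]_N -> R) : linear (h : _ -> R^o) -> continuous h.
Proof.
move=> /linear_functionalE/funext ->.
apply: (continuous_big add_continuous) => j _.
by apply: continuous_mulf; [exact: coord_continuous|exact: cst_continuous].
Qed.

Section Licq.
Variables (R : realType) (N D : nat) (I : finType).
Variables (g : I -> 'cV[R]_N -> R) (e : 'cV[R]_N -> R).
Hypothesis glin : forall i, linear (g i : _ -> R^o).
Hypothesis elin : linear (e : _ -> R^o).
Hypothesis ND : N = D.+1.

Let C : set 'cV[R]_N := [set v | (forall i, g i v <= 0) /\ e v = 1].

(* A point v lies in the relative interior of the face on which the constraints
   tight at v are equalities, and non-degeneracy says that the codimension of
   this face is the number of tight constraints: the gradients of these
   constraints and of [e] are linearly independent.  The conclusion is the dual
   form of this. *)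
Lemma licq (v : 'cV[R]_N) (i0 : I) :
  nondegenerate_polyhedron g C D -> C v -> g i0 v = 0 ->
  exists u, [/\ e u = 0, g i0 u = 1 &
                forall i, i != i0 -> g i v = 0 -> g i u = 0].
Proof.
move=> nd [gv ev] gi0.
pose T := [pred i | g i v == 0].
(* The normalisation [e] and the constraints tight at [v], stacked; the kernel [U] of this map is
   the direction space of the face around [v]. *)
pose phi u : 'rV[R]_(#|T|.+1) :=
  \row_j (if unlift ord0 j is Some s then g (enum_val s) u else e u).
have philin : linear phi.
  move=> a u w; apply/rowP => j; rewrite !mxE.
  by case: unliftP => [s|] _; rewrite ?glin ?elin.
pose Phi : {linear 'cV[R]_N -> 'rV[R]_(#|T|.+1)} :=
  HB.pack phi (GRing.isLinear.Build _ _ _ _ phi philin).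
pose U := lker (linfun Phi).
have UP u : u \in U <-> e u = 0 /\ (forall i, i \in T -> g i u = 0).
  rewrite memv_ker lfunE /=; split=> [/eqP/rowP phi0|[eu gu]].
    split; first by have := phi0 ord0; rewrite !mxE unlift_none.
    move=> i iT; have := phi0 (lift ord0 (enum_rank_in iT i)).
    by rewrite !mxE liftK enum_rankK_in.
  apply/eqP/rowP => j; rewrite !mxE; case: unliftP => [s|] _ //.
  by apply: gu; apply: enum_valP.
have gB i u w : g i (u - w) = g i u - g i w.
  by have := glin i (-1) w u; rewrite !scaleN1r (addrC (- w)) => ->; rewrite addrC.
have eB u w : e (u - w) = e u - e w.
  by have := elin (-1) w u; rewrite !scaleN1r (addrC (- w)) => ->; rewrite addrC.
(* Each tight constraint is nonpositive on [C], so their sum vanishes there only where all of them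
   do; this single functional exposes the face. *)
pose c : 'cV[R]_N := \col_j \sum_(i in T) g i (delta_mx j 0).
have cE w : (c^T *m w) 0 0 = \sum_(i in T) g i w.
  rewrite mxE; under eq_bigr do rewrite !mxE mulr_suml.
  rewrite exchange_big /=; apply: eq_bigr => i _.
  by rewrite (linear_functionalE (glin i) w); apply: eq_bigr => j _; rewrite mulrC.
pose F := C `&` [set w | (c^T *m w) 0 0 = 0].
have FP w : F w <-> C w /\ forall i, i \in T -> g i w = 0.
  rewrite /F /= cE; split=> -[Cw gw]; split=> //.
    move=> i iT; apply/eqP; rewrite -oppr_eq0; apply/eqP.
    have : \sum_(i in T) - g i w = 0 by rewrite sumrN gw oppr0.
    move/psumr_eq0P => -> // l _; rewrite oppr_ge0; exact: Cw.1.
  by rewrite big1.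
have faceF : is_face C F.
  exists c, 0; split=> // w [gw _]; rewrite cE.
  by apply: sumr_le0 => i _.
have Fv : F v by apply/FP; split=> // i /eqP.
have near_slack i : \forall w \near v, i \notin T -> g i w <= 0.
  case: (boolP (i \in T)) => iT; first exact: (@nearW _ (nbhs v)).
  have giv : g i v < 0 by rewrite lt_neqAle gv andbT; move: iT; rewrite inE.
  have nbi := linear_functional_continuous (glin i) (lt_nbhsl giv).
  by apply: (filterS (F := nbhs v) _ nbi) => w /ltW.
have nearF : \forall w \near v, w - v \in U -> F w.
  have all_slack : \forall w \near v, forall i, i \notin T -> g i w <= 0.
    exact: filter_forall (nbhs_filter v) near_slack.
  apply: (filterS (F := nbhs v) _ all_slack) => w gw /UP[eu gu].
  have ew : e w = 1 by apply/eqP; rewrite -ev -subr_eq0 -eB eu.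
  have gTw i : i \in T -> g i w = 0.
    by move=> iT; have := gu i iT; rewrite gB; move/eqP: (iT) => ->; rewrite subr0.
  apply/FP; split=> //; split=> // i.
  by case: (boolP (i \in T)) => [/gTw->|/gw].
have affF : affine_hull F = [set v + u | u in [set u | u \in U]].
  apply/seteqP; split=> w /=.
    move=> [r [a [p [Fp a1 ->]]]].
    exists (\sum_(i < r) a i *: (p i - v)).
      apply: rpred_sum => i _; apply: rpredZ; apply/UP.
      have [[_ ep] gp] := (FP _).1 (Fp i).
      split=> [|l lT]; first by rewrite eB ep ev subrr.
      by rewrite gB (gp _ lT); move/eqP: lT => ->; rewrite subrr.
    under [X in _ + X]eq_bigr do rewrite scalerBr.
    rewrite big_split /= sumrN -scaler_suml a1 scale1r.
    by rewrite addrCA subrr addr0.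
  (* [F] contains [v + t *: u] for small [t > 0], and [v + u] is the affine combination of [v] and
     that point with weights [1 - t^-1] and [t^-1]. *)
  move=> [u uU <-].
  have : \forall t \near 0^'+, F (v + t *: u).
    have tu : (v + t *: u) @[t --> (0:R)] --> v.
      rewrite -[X in _ --> X]addr0 -[X in _ + X](scale0r u).
      by apply: cvgD; [exact: cvg_cst|apply: cvgZr_tmp; exact: cvg_id].
    have nbt := cvg_at_right_filter tu nearF.
    apply: (filterS (F := 0^'+) _ nbt) => t; apply.
    by rewrite addrC addKr; exact: rpredZ.
  move=> /(filterI (nbhs_right_gt 0))/filter_ex[t [/= t0 Ft]].
  exists 2, (fun i => if i == 0 then 1 - t^-1 else t^-1),
    (fun i => if i == 0 then v else v + t *: u).
  split=> [i||]; first by case: eqP.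
    by rewrite big_ord_recl big_ord1 /= subrK.
  rewrite big_ord_recl big_ord1 /= scalerDr addrA -scalerDl subrK scale1r.
  by rewrite scalerA mulVf ?scale1r // gt_eqF.
have dimF : has_dim F (\dim U) by exists v, U.
have riF : rel_interior F v.
  split=> //; rewrite /within /= affF.
  apply: (filterS (F := nbhs v) _ nearF) => w Fw [u uU wE]; apply: Fw.
  by rewrite -wE addrC addKr.
have dimU := nd F (\dim U) v faceF dimF riF.
(* Rank-nullity: the image has dimension [D.+1 - \dim U = #|T|.+1], so the stacked map is onto and a
   basis vector of its target has a preimage. *)
have full : limg (linfun Phi) = fullv.
  have dimW : dim 'rV[R]_(#|T|.+1) = #|T|.+1.
    by rewrite dim_matrix; exact: mul1n.
  have dimV : dim 'cV[R]_N = (#|T| + \dim U).+1.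
    by rewrite dimU -ND dim_matrix; exact: muln1.
  apply/eqP; rewrite eqEdim subvf dimvf dimW.
  have := limg_ker_dim (linfun Phi) fullv.
  rewrite capfv -/U dimvf dimV -addSn addnC => /addIn ->.
  exact: leqnn.
have i0T : i0 \in T by apply/eqP.
pose b : 'rV[R]_(#|T|.+1) := delta_mx 0 (lift ord0 (enum_rank_in i0T i0)).
have /memv_imgP[u _ bE] : b \in limg (linfun Phi) by rewrite full memvf.
rewrite lfunE /= in bE; exists u; split.
- by have := congr1 (fun M : 'rV[R]_(#|T|.+1) => M 0 ord0) bE; rewrite !mxE unlift_none.
- have := congr1 (fun M : 'rV[R]_(#|T|.+1) => M 0 (lift ord0 (enum_rank_in i0T i0))) bE.
  by rewrite !mxE liftK enum_rankK_in // !eqxx.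
move=> i ii0 giv; have iT : i \in T by apply/eqP.
have := congr1 (fun M : 'rV[R]_(#|T|.+1) => M 0 (lift ord0 (enum_rank_in i0T i))) bE.
rewrite !mxE liftK enum_rankK_in // eqxx (inj_eq lift_inj) /= => <-.
case: eqP => // /(congr1 enum_val); rewrite !enum_rankK_in // => E.
by rewrite E eqxx in ii0.
Qed.

(** Complementarity makes multipliers of slack constraints zero. For a tight [i0], the direction
    given by [licq] kills every term of the identity except the one of [i0]. *)
Lemma multiplier_unique (v : 'cV[R]_N) (mu nu : I -> R) (s t : R) :
  nondegenerate_polyhedron g C D -> C v ->
  (forall i, mu i * g i v = 0) -> (forall i, nu i * g i v = 0) ->
  (forall u, \sum_i mu i * g i u + s * e u = \sum_i nu i * g i u + t * e u) ->
  mu =1 nu.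
Proof.
move=> nd Cv muv nuv eq_comb i0.
have [gi0|gi0] := eqVneq (g i0 v) 0; last first.
  by apply: (mulIf gi0); rewrite muv nuv.
have [u [eu gu0 gu]] := licq nd Cv gi0.
have pick (xi : I -> R) : (forall i, xi i * g i v = 0) ->
    \sum_i xi i * g i u = xi i0.
  move=> xiv; rewrite (bigD1 i0) //= gu0 mulr1 big1 ?addr0 // => i ii0.
  have /eqP := xiv i; rewrite mulf_eq0 => /orP[/eqP->|/eqP/gu->//].
    by rewrite mul0r.
  by rewrite mulr0.
by have := eq_comb u; rewrite eu !mulr0 !addr0 !pick.
Qed.
End Licq.

(** * Optimality on simplices and a minimax alternative *)

Lemma quadratic_slope_ge0 (R : realType) (a b : R) : 0 <= b ->
  (forall t, 0 < t -> t <= 1 -> 0 <= t * a + t ^+ 2 * b) -> 0 <= a.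
Proof.
move=> b0 ab; rewrite leNgt; apply/negP => a0.
have ba : 0 < b - a by lra.
(* At this step size [a + t * b] equals [- (a ^+ 2 / (b - a))], which is negative. *)
have t0 : 0 < - a / (b - a) by apply: divr_gt0 => //; lra.
have t1 : - a / (b - a) <= 1 by rewrite ler_pdivrMr // mul1r; lra.
have := ab _ t0 t1; rewrite leNgt => /negP; apply.
have -> : - a / (b - a) * a + (- a / (b - a)) ^+ 2 * b =
    - ((- a / (b - a)) * (a ^+ 2 / (b - a))) by field; lra.
rewrite oppr_lt0; apply: mulr_gt0 => //; apply: divr_gt0 => //.
by rewrite exprn_even_gt0 //= lt_eqF.
Qed.

Lemma delta_simplex (R : realType) (N : nat) (i : 'I_N) :
  simplex R N (delta_mx i 0).
Proof.
split=> [j|]; first by rewrite mxE eqxx andbT; case: eqP.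
rewrite (bigD1 i) //= mxE !eqxx big1 ?addr0 // => j ji.
by rewrite mxE (negbTE ji).
Qed.

Lemma simplex_segment (R : realType) (N : nat) (x x' : 'cV[R]_N) (t : R) :
  simplex R N x -> simplex R N x' -> 0 < t -> t <= 1 ->
  simplex R N (x + t *: (x' - x)).
Proof.
move=> [x0 x1] [x'0 x'1] t0 t1; split=> [i|].
  rewrite !mxE; have := x0 i; have := x'0 i; nra.
under eq_bigr do rewrite !mxE.
by rewrite big_split /= -mulr_sumr big_split /= sumrN x1 x'1 subrr mulr0 addr0.
Qed.

(** Testing against vertices bounds each [a i] by the mean [p]; the gaps [p - a i] are nonnegative
    with weighted sum zero, so each weighted gap vanishes. *)
Lemma simplex_complementarity (R : realType) (N : nat) (a : 'I_N -> R)
    (x : 'cV[R]_N) : simplex R N x ->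
  (forall x', simplex R N x' ->
     \sum_i x' i 0 * a i <= \sum_i x i 0 * a i) ->
  forall i, a i <= \sum_i x i 0 * a i /\
            x i 0 * (a i - \sum_i x i 0 * a i) = 0.
Proof.
move=> [x0 x1] xmax; set p := \sum_i _.
have ap i : a i <= p.
  apply: le_trans (xmax _ (delta_simplex R i)).
  rewrite (bigD1 i) //= mxE !eqxx mul1r big1 ?addr0 // => j ji.
  by rewrite mxE (negbTE ji) mul0r.
move=> i; split=> //; apply/eqP; rewrite -oppr_eq0 -mulrN opprB; apply/eqP.
have : \sum_i x i 0 * (p - a i) = 0.
  under eq_bigr do rewrite mulrBr.
  by rewrite big_split /= -mulr_suml x1 mul1r sumrN subrr.
by move/psumr_eq0P => -> // j _; rewrite mulr_ge0 // subr_ge0.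
Qed.

Lemma simplex_compact (R : realType) (N : nat) : compact (simplex R N).
Proof.
pose box := [set v : 'rV[R]_N | forall i, `[0, 1]%classic (v ord0 i)].
have cbox : compact box by exact: (rV_compact (fun i => @segment_compact R 0 1)).
have ctr : continuous (@trmx R 1 N).
  by apply: continuous_trmx; exact: id_continuous.
have cimg : compact (@trmx R 1 N @` box).
  by apply: continuous_compact => //; apply: continuous_subspaceT.
apply: subclosed_compact cimg _ => [|x [x0 x1]].
  have -> : simplex R N = (\bigcap_i [set x | 0 <= x i 0]) `&`
      [set x | \sum_i x i 0 = 1].
    by apply/seteqP; split=> x [x0 x1]; split=> // i; [move=> _|]; exact: x0.
  apply: closedI.
    apply: closed_bigI => i _.
    apply: (closed_comp (f := fun x : 'cV[R]_N => x i 0) (D := [set r | 0 <= r])).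
      by move=> x _; exact: coord_continuous.
    exact: closed_ge.
  apply: (closed_comp (f := fun x : 'cV[R]_N => \sum_i x i 0) (D := [set 1])).
    move=> x _; apply: (continuous_big add_continuous) => i _.
    exact: coord_continuous.
  exact: closed_eq.
exists x^T; last by rewrite trmxK.
move=> i; rewrite /= in_itv /= mxE x0 -x1 (bigD1 i) //= lerDl.
by apply: sumr_ge0 => j _; exact: x0.
Qed.

Lemma simplex_neq0 (R : realType) (N : nat) : (0 < N)%N -> simplex R N !=set0.
Proof. by move=> N0; exists (delta_mx (Ordinal N0) 0); apply: delta_simplex. Qed.

Lemma mulmx_coord_continuous (R : realType) (m n : nat) (M : 'M[R]_(m, n)) i :
  continuous (fun y : 'cV[R]_n => (M *m y) i 0).
Proof.
apply: continuous_coord.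
by apply: continuous_mulmx; [exact: cst_continuous|exact: id_continuous].
Qed.

(* If x minimises the squared shortfall of [x^T M] below [c] and the shortfall
   is not zero, then the normalised shortfall is a mixed column which keeps
   every row below [c]. *)
Lemma minimax_alternative (R : realType) (m n : nat) (M : 'M[R]_(m, n)) (c : R) :
  (0 < m)%N ->
  (forall y, simplex R n y -> exists i, c <= (M *m y) i 0) ->
  exists2 x, simplex R m x & forall j, c <= (M^T *m x) j 0.
Proof.
move=> m0 Mc.
pose gap (x : 'cV[R]_m) j : R := Num.max 0 (c - (M^T *m x) j 0).
pose f (x : 'cV[R]_m) : R := \sum_j gap x j ^+ 2.
have fc : continuous f.
  apply: (continuous_big add_continuous) => j _.
  have gc : continuous (gap^~ j).
    have cgap : continuous (fun x : 'cV[R]_m => c - (M^T *m x) j 0).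
      apply: continuous_subf; first exact: cst_continuous.
      exact: mulmx_coord_continuous.
    move=> x.
    exact: (continuous_max (f := fun=> 0) (@cst_continuous _ _ 0 x) (cgap x)).
  by under eq_fun do rewrite expr2; apply: continuous_mulf.
have [x /set_mem xS xmin] := compact_EVT_min (simplex_neq0 R m0)
  (@simplex_compact R m) (continuous_subspaceT fc).
exists x => // j0; rewrite leNgt; apply/negP => cj0.
pose r j := gap x j.
have r_ge0 j : 0 <= r j by rewrite /r /gap le_max lexx.
pose b i j := (M i j - (M^T *m x) j 0).
(* First-order condition at the minimiser [x] towards vertex [i]; [b i j] is the rate of change of
   [(M^T *m x) j 0] in that direction. *)
have slope i : \sum_j r j * b i j <= 0.
  have := @quadratic_slope_ge0 R (- (2 * \sum_j r j * b i j)) (\sum_j b i j ^+ 2).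
  suff : forall t, 0 < t -> t <= 1 ->
    0 <= t * - (2 * \sum_j r j * b i j) + t ^+ 2 * \sum_j b i j ^+ 2.
    move=> H /(_ _ H); rewrite sumr_ge0 => [/(_ isT)|j _]; last exact: sqr_ge0.
    lra.
  move=> t t0 t1.
  have xt : simplex R m (x + t *: (delta_mx i 0 - x)).
    by apply: simplex_segment => //; exact: delta_simplex.
  have := xmin _ (mem_set xt); rewrite -subr_ge0.
  move=> /le_trans; apply.
  have -> : t * - (2 * \sum_j r j * b i j) + t ^+ 2 * \sum_j b i j ^+ 2 =
      \sum_j (r j - t * b i j) ^+ 2 - f x.
    rewrite /f -sumrB mulrN mulrA !mulr_sumr -sumrN -big_split /=.
    by apply: eq_bigr => j _; rewrite /r; ring.
  (* The truncation [max 0 (p - q)] is at most [max 0 p - q] in absolute value, so [f] along the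
     segment lies below a genuine quadratic in [t]. *)
  rewrite lerB // /f; apply: ler_sum => j _.
  have -> : gap (x + t *: (delta_mx i 0 - x)) j =
      Num.max 0 (c - (M^T *m x) j 0 - t * b i j).
    rewrite /gap mulmxDr -scalemxAr mulmxBr -colE !mxE.
    by congr Num.max; rewrite /b !mxE; ring.
  rewrite /r /gap; move: (c - _) (t * _) => p q.
  by case: (lerP 0 p) => h1; case: (lerP 0 (p - q)) => h2; nra.
pose S := \sum_j r j.
have rj0 : 0 < r j0 by rewrite /r /gap lt_max subr_gt0 cj0 orbT.
have S0 : 0 < S.
  by rewrite /S (bigD1 j0) //= ltr_pwDl // sumr_ge0.
pose y : 'cV[R]_n := \col_j (r j / S).
have yS : simplex R n y.
  split=> [j|]; first by rewrite mxE divr_ge0 // ltW.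
  by under eq_bigr do rewrite mxE; rewrite -mulr_suml divff // gt_eqF.
have [i ci] := Mc y yS.
have : c * S <= \sum_j r j * M i j.
  rewrite -ler_pdivlMr // (le_trans ci) // mxE mulr_suml le_eqVlt; apply/orP; left.
  by apply/eqP/eq_bigr => j _; rewrite mxE mulrCA mulrA.
(* By [slope], the [r]-weighted sum of row [i] is at most that of [M^T *m x]. The latter is strictly
   below [c * S]: columns with positive weight fall short of [c], and [j0] is one of them. *)
apply/negP; rewrite -ltNge.
have -> : \sum_j r j * M i j =
    \sum_j r j * b i j + \sum_j r j * (M^T *m x) j 0.
  by rewrite -big_split /=; apply: eq_bigr => j _; rewrite /b; ring.
apply: le_lt_trans (_ : \sum_j r j * (M^T *m x) j 0 < _).
  by rewrite gerDr.
rewrite /S mulr_sumr (bigD1 j0) //= [ltRHS](bigD1 j0) //= ltr_leD //.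
  by rewrite mulrC ltr_pM2r.
apply: ler_sum => j _; rewrite mulrC /r /gap.
by case: (lerP 0 (c - _)) => h; rewrite ?mulr0 ?mul0r // ler_wpM2r //; lra.
Qed.

(** * The parametrised zero-sum game and its saddle points *)

Definition beta_mx (R : realType) (n k : nat) (beta : k.-tuple 'cV[R]_n) :
    'M[R]_(n, k) := \matrix_(j, l) tnth beta l j 0.

Section Game.
Variables (R : realType) (m n k : nat) (A : 'M[R]_(m, n)).
Variable beta : k.-tuple 'cV[R]_n.

Local Notation B := (beta_mx beta).

Definition dot (u v : 'rV[R]_k) : R := (u *m v^T) 0 0.

Lemma dotE u v : dot u v = \sum_l u 0 l * v 0 l.
Proof. by rewrite /dot mxE; apply: eq_bigr => l _; rewrite mxE. Qed.

Lemma gameE (alpha : 'M[R]_(m, k)) : game A beta alpha = (A, - A + alpha *m B^T).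
Proof.
rewrite /game; congr (_, - A + _); apply/matrixP => i j.
rewrite summxE mxE; apply: eq_bigr => l _.
by rewrite !mxE big_ord1 !mxE.
Qed.

(** The function [payoff A x y - dot lam (y^T *m B)] is maximised in [x] and minimised in [y]; its
    second term does not involve [x] and so cancels from the first inequality. *)
Definition saddle (lam : 'rV[R]_k) (x : 'cV[R]_m) (y : 'cV[R]_n) : Prop :=
  [/\ simplex R m x, simplex R n y,
      forall x', simplex R m x' -> payoff A x' y <= payoff A x y &
      forall y', simplex R n y' ->
        payoff A x y - dot lam (y^T *m B) <= payoff A x y' - dot lam (y'^T *m B)].

Lemma payoff_game2 (alpha : 'M[R]_(m, k)) x y :
  payoff (game A beta alpha).2 x y =
  - payoff A x y + dot (x^T *m alpha) (y^T *m B).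
Proof.
rewrite gameE /payoff /dot /= mulmxDr mulmxDl mulmxN mulNmx mxE.
rewrite [X in X + _]mxE.
by rewrite trmx_mul trmxK !mulmxA.
Qed.

Lemma nash_saddle (alpha : 'M[R]_(m, k)) x y :
  nash (game A beta alpha) x y <-> saddle (x^T *m alpha) x y.
Proof.
split=> -[xS yS xopt yopt]; split=> // y' y'S; have := yopt _ y'S;
  rewrite !payoff_game2; lra.
Qed.

Lemma payoffEx (x : 'cV[R]_m) (y : 'cV[R]_n) :
  payoff A x y = \sum_i x i 0 * (A *m y) i 0.
Proof. by rewrite /payoff -mulmxA mxE; apply: eq_bigr => i _; rewrite mxE. Qed.

Lemma payoffEy (x : 'cV[R]_m) (y : 'cV[R]_n) :
  payoff A x y = \sum_j y j 0 * (x^T *m A) 0 j.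
Proof. by rewrite /payoff mxE; apply: eq_bigr => j _; rewrite mulrC. Qed.

Lemma dot_mulBE (lam : 'rV[R]_k) (y : 'cV[R]_n) :
  dot lam (y^T *m B) = \sum_j y j 0 * (lam *m B^T) 0 j.
Proof.
rewrite /dot trmx_mul trmxK mulmxA mxE.
by apply: eq_bigr => j _; rewrite mulrC.
Qed.

(** Interchangeability of equilibria in a zero-sum game: testing each saddle against the other gives
    a cycle of four inequalities, hence four equalities. *)
Lemma saddle_swap lam x y x' y' :
  saddle lam x y -> saddle lam x' y' -> saddle lam x y'.
Proof.
move=> [xS yS xopt yopt] [x'S y'S x'opt y'opt]; split=> //.
  move=> x'' x''S; have := x'opt _ x''S.
  by have := yopt _ y'S; have := y'opt _ yS; have := xopt _ x'S; lra.
move=> y'' y''S; have := yopt _ y''S; have := x'opt _ xS.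
by have := y'opt _ yS; have := xopt _ x'S; lra.
Qed.

(** Add the four inequalities that test each saddle against the strategies of the other; the payoff
    terms cancel. *)
Lemma saddle_monotone lam x y lam' x' y' :
  saddle lam x y -> saddle lam' x' y' ->
  0 <= dot (lam - lam') (y^T *m B - y'^T *m B).
Proof.
move=> [xS yS xopt yopt] [x'S y'S x'opt y'opt].
have dotBB (a b c d : 'rV[R]_k) :
    dot (a - b) (c - d) = dot a c - dot a d - dot b c + dot b d.
  rewrite !dotE -!sumrB -big_split /=; apply: eq_bigr => l _.
  by rewrite !mxE; ring.
rewrite dotBB; have := x'opt _ xS; have := yopt _ y'S; have := y'opt _ yS.
by have := xopt _ x'S; lra.
Qed.

(** With equal sums, the two factors in [saddle_monotone] are opposite, so minus the squared norm of
    [lam - lam'] is nonnegative. *)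
Lemma saddle_parameter_unique lam x y lam' x' y' :
  saddle lam x y -> saddle lam' x' y' ->
  lam + y^T *m B = lam' + y'^T *m B -> lam = lam'.
Proof.
move=> s s' eq_z; have := saddle_monotone s s'.
have -> : y^T *m B - y'^T *m B = - (lam - lam').
  by rewrite opprB; apply: (addrI lam); rewrite addrA eq_z addrK addrC subrK.
rewrite dotE => sq_le0; apply/rowP => l; apply/eqP; rewrite -subr_eq0.
have : \sum_l (lam 0 l - lam' 0 l) ^+ 2 = 0.
  apply/eqP; rewrite eq_le sumr_ge0 => [|i _]; last exact: sqr_ge0.
  rewrite andbT -oppr_ge0 -sumrN; move: sq_le0; congr (0 <= _).
  by apply: eq_bigr => i _; rewrite !mxE; ring.
move/psumr_eq0P => sq0; rewrite -sqrf_eq0; apply/eqP; apply: sq0 => // i _.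
exact: sqr_ge0.
Qed.

(** * Saddles as complementary points of the two polyhedra *)

Let eP (v : 'cV[R]_(n + 1)) : R := \sum_(j < n) usubmx v j 0.

Let eQ (v : 'cV[R]_(m + k + 1)) : R := \sum_(i < m) usubmx (usubmx v) i 0.

Lemma P_ineq_linear i : linear (P_ineq A i : _ -> R^o).
Proof.
move=> a u v; case: i => [i|j] /=; last by rewrite !mxE; rewrite /GRing.scale /=; ring.
rewrite linearP mulmxDr -scalemxAr !mxE /GRing.scale /=; ring.
Qed.

Lemma eP_linear : linear (eP : _ -> R^o).
Proof.
move=> a u v; rewrite /eP /GRing.scale /= mulr_sumr -big_split /=.
by apply: eq_bigr => j _; rewrite !mxE.
Qed.

Lemma Q_ineq_inr j v : Q_ineq A beta (inr j) v =
  - (\sum_i usubmx (usubmx v) i 0 * A i j)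
  + \sum_l dsubmx (usubmx v) l 0 * B j l - dsubmx v 0 0.
Proof.
congr (- _ + _ - _).
  by rewrite mxE; apply: eq_bigr => i _; congr (_ * _); rewrite mxE.
by apply: eq_bigr => l _; rewrite mulrC; congr (_ * _); rewrite [RHS]mxE.
Qed.

Lemma Q_ineq_linear i : linear (Q_ineq A beta i : _ -> R^o).
Proof.
move=> a u v; case: i => [i|j]; first by rewrite /= !mxE /GRing.scale /=; ring.
have sum_linear (I : finType) (f g h c : I -> R) :
    (forall l, h l = a * f l + g l) ->
    \sum_l h l * c l = a * (\sum_l f l * c l) + \sum_l g l * c l.
  move=> hE; rewrite mulr_sumr -big_split /=; apply: eq_bigr => l _.
  by rewrite hE; ring.
rewrite !Q_ineq_inr /GRing.scale /=.
rewrite (sum_linear _ (fun i => usubmx (usubmx u) i 0)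
  (fun i => usubmx (usubmx v) i 0)) => [|i]; last by rewrite !mxE.
rewrite (sum_linear _ (fun i => dsubmx (usubmx u) i 0)
  (fun i => dsubmx (usubmx v) i 0)) => [|i]; last by rewrite !mxE.
rewrite (_ : dsubmx (a *: u + v) 0 0 = a * dsubmx u 0 0 + dsubmx v 0 0).
  by ring.
by rewrite !mxE.
Qed.

Lemma eQ_linear : linear (eQ : _ -> R^o).
Proof.
move=> a u v; rewrite /eQ /GRing.scale /= mulr_sumr -big_split /=.
by apply: eq_bigr => j _; rewrite !mxE.
Qed.

#[local] Arguments P_ineq : simpl never.
#[local] Arguments Q_ineq : simpl never.

Lemma Q_ineq_inrE j v : Q_ineq A beta (inr j) v =
  - ((usubmx (usubmx v))^T *m A) 0 j + ((dsubmx (usubmx v))^T *m B^T) 0 j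
  - dsubmx v 0 0.
Proof.
congr (_ + _ - _); rewrite mxE; apply: eq_bigr => l _.
by rewrite mulrC [in RHS]mxE; congr (_ * _); rewrite !mxE.
Qed.

(** Here and in [Q_point] the last coordinate is a player's payoff at [(x, y)]. At a saddle it is
    the best payoff of a pure strategy, so that feasibility expresses the best-reply condition. *)
Definition P_point (x : 'cV[R]_m) (y : 'cV[R]_n) : 'cV[R]_(n + 1) :=
  col_mx y (payoff A x y)%:M.

Definition Q_point (lam : 'rV[R]_k) (x : 'cV[R]_m) (y : 'cV[R]_n) :
    'cV[R]_(m + k + 1) :=
  col_mx (col_mx x lam^T) (dot lam (y^T *m B) - payoff A x y)%:M.

Lemma P_ineq_point x y i :
  P_ineq A (inl i) (P_point x y) = (A *m y) i 0 - payoff A x y.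
Proof.
rewrite /P_ineq /P_point col_mxKu col_mxKd.
by congr (_ - _); rewrite mxE eqxx.
Qed.

Lemma Q_ineq_point lam x y j : Q_ineq A beta (inr j) (Q_point lam x y) =
  - (x^T *m A) 0 j + (lam *m B^T) 0 j - (dot lam (y^T *m B) - payoff A x y).
Proof.
rewrite Q_ineq_inrE /Q_point !col_mxKu !col_mxKd trmxK.
by congr (_ - _); rewrite mxE eqxx.
Qed.

Lemma saddle_P lam x y : saddle lam x y ->
  P A (P_point x y) /\ forall i, x i 0 * P_ineq A (inl i) (P_point x y) = 0.
Proof.
move=> [xS [y0 y1] xopt _].
have [] : (forall i, (A *m y) i 0 <= payoff A x y) /\
    (forall i, x i 0 * ((A *m y) i 0 - payoff A x y) = 0).
  apply: all_and2 => i; rewrite payoffEx.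
  apply: (simplex_complementarity (a := fun i => (A *m y) i 0)) => // x' x'S.
  by rewrite -!payoffEx; exact: xopt.
move=> le_pay compl; split=> [|i]; last by rewrite P_ineq_point.
split=> [[i|j]|]; first by rewrite P_ineq_point subr_le0.
  by rewrite /P_ineq /P_point col_mxKu oppr_le0.
by rewrite /P_point col_mxKu.
Qed.

Lemma saddle_Q lam x y : saddle lam x y ->
  Q A beta (Q_point lam x y) /\
  forall j, y j 0 * Q_ineq A beta (inr j) (Q_point lam x y) = 0.
Proof.
move=> [[x0 x1] yS _ yopt].
pose a j := - (x^T *m A) 0 j + (lam *m B^T) 0 j.
have aE (y' : 'cV[R]_n) : \sum_j y' j 0 * a j = dot lam (y'^T *m B) - payoff A x y'.
  rewrite dot_mulBE payoffEy -sumrB; apply: eq_bigr => j _; rewrite /a; ring.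
have [] : (forall j, a j <= dot lam (y^T *m B) - payoff A x y) /\
    (forall j, y j 0 * (a j - (dot lam (y^T *m B) - payoff A x y)) = 0).
  apply: all_and2 => j; rewrite -aE; apply: simplex_complementarity => // y' y'S.
  by rewrite !aE; have := yopt _ y'S; lra.
move=> le_pay compl; split=> [|j]; last by rewrite Q_ineq_point.
split=> [[i|j]|].
- by rewrite /Q_ineq /Q_point !col_mxKu oppr_le0.
- by rewrite Q_ineq_point subr_le0; exact: le_pay.
by rewrite /Q_point !col_mxKu.
Qed.

(* Given y, the weights x and the slacks of the constraints of Q'^k form
   multipliers, at a point of P, of a linear functional independent of x;
   [saddle_unique_y] exchanges the roles of P and Q'^k. *)
Lemma saddle_unique_x lam x x' y :
  nondegenerate_polyhedron (P_ineq A) (P A) n ->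
  saddle lam x y -> saddle lam x' y -> x = x'.
Proof.
move=> hP s s'; have pay : payoff A x' y = payoff A x y.
  case: s s' => xS _ xopt _ [x'S _ x'opt _].
  by apply/eqP; rewrite eq_le xopt // x'opt.
have [Pv compl] := saddle_P s; have [_ compl'] := saddle_P s'.
have [_ complQ] := saddle_Q s; have [_ complQ'] := saddle_Q s'.
pose mu (z : 'cV[R]_m) (i : 'I_m + 'I_n) :=
  match i with
  | inl i => z i 0
  | inr j => - Q_ineq A beta (inr j) (Q_point lam z y)
  end.
have mu_tight (z : 'cV[R]_m) : (forall i, z i 0 * P_ineq A (inl i) (P_point z y) = 0) ->
    (forall j, y j 0 * Q_ineq A beta (inr j) (Q_point lam z y) = 0) ->
    payoff A z y = payoff A x y ->
    forall i, mu z i * P_ineq A i (P_point x y) = 0.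
  move=> cP cQ pz [i|j]; first by rewrite /mu P_ineq_point -pz -P_ineq_point.
  by rewrite /mu /P_ineq /P_point col_mxKu mulrNN mulrC; exact: cQ.
(* With the second player's payoff as coefficient of [eP], all terms in [z] cancel and the
   functional depends on [lam] alone. *)
have mu_comb z u : simplex R m z ->
    \sum_i mu z i * P_ineq A i u +
    (dot lam (y^T *m B) - payoff A z y) * eP u =
    dot lam ((usubmx u)^T *m B) - dsubmx u 0 0.
  move=> [_ z1]; rewrite big_sumType /=.
  have -> : \sum_i z i 0 * P_ineq A (inl i) u =
      payoff A z (usubmx u) - dsubmx u 0 0.
    rewrite payoffEx -[in RHS](mul1r (dsubmx u 0 0)) -z1 mulr_suml -sumrB.
    by apply: eq_bigr => i _; rewrite mulrBr.
  have : \sum_j - Q_ineq A beta (inr j) (Q_point lam z y) *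
        P_ineq A (inr j) u +
      (dot lam (y^T *m B) - payoff A z y) * eP u =
      dot lam ((usubmx u)^T *m B) - payoff A z (usubmx u).
    rewrite [RHS](congr2 +%R (dot_mulBE _ _) (congr1 -%R (payoffEy _ _))).
    rewrite /eP mulr_sumr -big_split -sumrB /=.
    by apply: eq_bigr => j _; rewrite Q_ineq_point /P_ineq; ring.
  by move=> comb; rewrite -addrA comb; ring.
have H := @multiplier_unique R (n + 1) n _ (P_ineq A) eP P_ineq_linear
  eP_linear (addn1 n) (P_point x y) (mu x) (mu x')
  (dot lam (y^T *m B) - payoff A x y) (dot lam (y^T *m B) - payoff A x' y) hP Pv
  (mu_tight _ compl complQ erefl) (mu_tight _ compl' complQ' pay).
apply/colP => i; apply: (H _ (inl i)) => u.
by rewrite !mu_comb; [|case: s'|case: s].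
Qed.

Lemma saddle_unique_y lam x y y' :
  nondegenerate_polyhedron (Q_ineq A beta) (Q A beta) (m + k) ->
  saddle lam x y -> saddle lam x y' -> y^T *m B = y'^T *m B -> y = y'.
Proof.
move=> hQ s s' eqB; have pay : payoff A x y' = payoff A x y.
  case: s s' => xS yS _ yopt [_ y'S _ y'opt].
  have := yopt _ y'S; have := y'opt _ yS; rewrite eqB; lra.
have [_ compl] := saddle_P s; have [_ compl'] := saddle_P s'.
have [Qv complQ] := saddle_Q s; have [_ complQ'] := saddle_Q s'.
pose mu (z : 'cV[R]_n) (i : 'I_m + 'I_n) :=
  match i with
  | inl i => - P_ineq A (inl i) (P_point x z)
  | inr j => z j 0
  end.
have mu_tight (z : 'cV[R]_n) : (forall i, x i 0 * P_ineq A (inl i) (P_point x z) = 0) ->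
    (forall j, z j 0 * Q_ineq A beta (inr j) (Q_point lam x z) = 0) ->
    payoff A x z = payoff A x y -> z^T *m B = y^T *m B ->
    forall i, mu z i * Q_ineq A beta i (Q_point lam x y) = 0.
  move=> cP cQ pz zB [i|j]; last by rewrite /mu Q_ineq_point -pz -zB -Q_ineq_point.
  by rewrite /mu /Q_ineq /Q_point !col_mxKu mulrNN mulrC; exact: cP.
(* This functional still contains [z^T *m B], its only trace of [z]; hence the hypothesis that [y]
   and [y'] agree after multiplication by [B]. *)
have mu_comb z u : simplex R n z ->
    \sum_i mu z i * Q_ineq A beta i u + payoff A x z * eQ u =
    dot (dsubmx (usubmx u))^T (z^T *m B) - dsubmx u 0 0.
  move=> [_ z1]; rewrite big_sumType /=.
  have -> : \sum_j z j 0 * Q_ineq A beta (inr j) u =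
      dot (dsubmx (usubmx u))^T (z^T *m B) - payoff A (usubmx (usubmx u)) z
      - dsubmx u 0 0.
    rewrite payoffEy dot_mulBE -[in RHS](mul1r (dsubmx u 0 0)) -z1 mulr_suml.
    rewrite -!sumrB; apply: eq_bigr => j _.
    by rewrite Q_ineq_inrE; ring.
  have : \sum_i - P_ineq A (inl i) (P_point x z) *
        Q_ineq A beta (inl i) u +
      payoff A x z * eQ u = payoff A (usubmx (usubmx u)) z.
    rewrite [RHS]payoffEx /eQ mulr_sumr -big_split /=.
    by apply: eq_bigr => i _; rewrite P_ineq_point /Q_ineq; ring.
  by move=> comb; rewrite addrAC comb; ring.
have H := @multiplier_unique R (m + k + 1) (m + k) _ (Q_ineq A beta) eQ
  Q_ineq_linear eQ_linear (addn1 (m + k)) (Q_point lam x y) (mu y) (mu y')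
  (payoff A x y) (payoff A x y') hQ Qv (mu_tight _ compl complQ erefl erefl)
  (mu_tight _ compl' complQ' pay (esym eqB)).
apply/colP => j; apply: (H _ (inr j)) => u.
by rewrite !mu_comb ?eqB; [|case: s'|case: s].
Qed.

(** Once the parameters agree, [(x, y')] is a saddle too, so [x] and [y] can be compared one at a
    time. *)
Lemma saddle_unique lam x y lam' x' y' :
  nondegenerate_polyhedron (P_ineq A) (P A) n ->
  nondegenerate_polyhedron (Q_ineq A beta) (Q A beta) (m + k) ->
  saddle lam x y -> saddle lam' x' y' ->
  lam + y^T *m B = lam' + y'^T *m B -> x = x' /\ y = y'.
Proof.
move=> hP hQ s s' eq_z; have eq_lam := saddle_parameter_unique s s' eq_z.
rewrite -eq_lam in s' eq_z; move/addrI: eq_z => eq_yB; split.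
  exact: saddle_unique_x hP (saddle_swap s s') s'.
exact: saddle_unique_y hQ s (saddle_swap s s') eq_yB.
Qed.

(** * Existence of a saddle for each coordinate [z] *)

(** The first-order condition for the penalised minimiser [y] says that [y] also minimises
    [mx - dot lam (_^T *m B)] with [lam = z - y^T *m B]; the minimax alternative then provides
    [x]. *)
Lemma saddle_exists (z : 'rV[R]_k) : (0 < m)%N -> (0 < n)%N ->
  exists x y, saddle (z - y^T *m B) x y.
Proof.
move=> m0 n0; pose i0 := Ordinal m0.
(* The default of the maximum is itself the entry of a row, so it does not alter the maximum. *)
pose mx (y : 'cV[R]_n) : R := \big[Num.max/(A *m y) i0 0]_i (A *m y) i 0.
have le_mx y i : (A *m y) i 0 <= mx y.
  exact: (le_bigmax _ (fun i => (A *m y) i 0)).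
have mx_attained y : exists i, mx y <= (A *m y) i 0.
  have /bigmax_geP[h|[i _ h]] := lexx (mx y); first by exists i0.
  by exists i.
pose q (y : 'cV[R]_n) : R := \sum_l (z 0 l - (y^T *m B) 0 l) ^+ 2.
(* Twice the objective [mx + q / 2]; the derivative of [q / 2] at the minimiser along [d] will be
   [- dot lam d]. *)
pose phi y := mx y + (mx y + q y).
have mxc : continuous mx.
  by apply: continuous_bigmax => *; exact: mulmx_coord_continuous.
have qc : continuous q.
  apply: (continuous_big add_continuous) => l _.
  under eq_fun do rewrite expr2.
  have c1 : continuous (fun y : 'cV[R]_n => z 0 l - (y^T *m B) 0 l).
    apply: continuous_subf; first exact: cst_continuous.
    apply: continuous_coord; apply: continuous_mulmx; last exact: cst_continuous.
    by apply: continuous_trmx; exact: id_continuous.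
  exact: continuous_mulf.
have phic : continuous phi by do 2!apply: continuous_addf => //.
have [y /set_mem yS ymin] := compact_EVT_min (simplex_neq0 R n0)
  (@simplex_compact R n) (continuous_subspaceT phic).
pose lam := z - y^T *m B; pose c := mx y - dot lam (y^T *m B).
have c_le y' : simplex R n y' -> c <= mx y' - dot lam (y'^T *m B).
  move=> y'S; pose d := y'^T *m B - y^T *m B.
  (* first-order optimality of y, the maximum in [mx] being convex *)
  have slope : 0 <= 2 * (mx y' - mx y) - 2 * dot lam d.
    apply: (@quadratic_slope_ge0 R _ (\sum_l d 0 l ^+ 2)) => [|t t0 t1].
      by apply: sumr_ge0 => l _; exact: sqr_ge0.
    have := ymin _ (mem_set (simplex_segment yS y'S t0 t1)).
    have mx_le : mx (y + t *: (y' - y)) <= mx y + t * (mx y' - mx y).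
      have [i /le_trans] := mx_attained (y + t *: (y' - y)); apply.
      have := le_mx y' i; have := le_mx y i; rewrite mulmxDr -scalemxAr mulmxBr.
      by move: (A *m y) (A *m y') => a a'; rewrite !mxE; nra.
    have q_eq : q (y + t *: (y' - y)) =
        q y - 2 * t * dot lam d + t ^+ 2 * \sum_l d 0 l ^+ 2.
      rewrite dotE /q !mulr_sumr -sumrB -big_split /=; apply: eq_bigr => l _.
      have -> : ((y + t *: (y' - y))^T *m B) 0 l = (y^T *m B) 0 l + t * d 0 l.
        by rewrite linearD linearZ linearB /= mulmxDl -scalemxAl mulmxBl
          [LHS]mxE [in LHS](mxE _ (t *: _)).
      rewrite [lam 0 l]mxE [(- _ : 'rV__) 0 l]mxE; ring.
    rewrite /phi q_eq; lra.
  have dotd : dot lam d = dot lam (y'^T *m B) - dot lam (y^T *m B).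
    rewrite !dotE -sumrB; apply: eq_bigr => l _.
    by rewrite [d 0 l]mxE [(- _ : 'rV__) 0 l]mxE mulrBr.
  by move: slope; rewrite dotd /c; lra.
(* Shifting each column by a constant absorbs the term in [lam]; by [c_le], every mixed column has a
   row that reaches [c]. *)
pose M : 'M[R]_(m, n) := \matrix_(i, j) (A i j - (lam *m B^T) 0 j).
have ME (y' : 'cV[R]_n) i :
    (M *m y') i 0 = (A *m y') i 0 - dot lam (y'^T *m B).
  rewrite dot_mulBE !mxE -sumrB; apply: eq_bigr => j _.
  by rewrite [M i j]mxE mulrBl [X in _ - X]mulrC.
have Mc y' : simplex R n y' -> exists i, c <= (M *m y') i 0.
  move=> y'S; have [i mxi] := mx_attained y'; exists i.
  by rewrite ME; have := c_le _ y'S; lra.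
have [x xS xc] := minimax_alternative m0 Mc.
have le_pay (y' : 'cV[R]_n) : simplex R n y' ->
    c <= payoff A x y' - dot lam (y'^T *m B).
  move=> [y'0 y'1]; rewrite -[c]mul1r -y'1 mulr_suml payoffEy dot_mulBE -sumrB.
  apply: ler_sum => j _; rewrite -mulrBr ler_wpM2l //.
  apply: le_trans (xc j) _; rewrite le_eqVlt; apply/orP; left; apply/eqP.
  rewrite -[X in _ - X]mul1r -(proj2 xS) mulr_suml !mxE -sumrB.
  by apply: eq_bigr => i _; rewrite !mxE; ring.
have pay_le x' : simplex R m x' -> payoff A x' y <= mx y.
  move=> [x'0 x'1]; rewrite payoffEx -[mx y]mul1r -x'1 mulr_suml.
  by apply: ler_sum => i _; rewrite ler_wpM2l.
(* At [(x, y)] the bounds [le_pay] and [pay_le] meet and force [payoff A x y = mx y], so each of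
   them becomes an optimality condition. *)
exists x, y; split=> //.
  by move=> x' /pay_le; have := le_pay _ yS; rewrite /c; lra.
by move=> y' /le_pay; have := pay_le _ xS; rewrite /c -/lam; lra.
Qed.

End Game.

(** * Continuous dependence of the saddle on [z] *)

(** The saddle inequalities are closed in [(z, x, y)], so any cluster point of the chosen saddles at
    [z] is a saddle for [z], and uniqueness identifies it with [s z]. Compactness of the simplices
    turns this into convergence. *)
Lemma saddle_selection (R : realType) (m n k : nat) (A : 'M[R]_(m, n))
    (beta : k.-tuple 'cV[R]_n) : (0 < m)%N -> (0 < n)%N ->
  nondegenerate_polyhedron (P_ineq A) (P A) n ->
  nondegenerate_polyhedron (Q_ineq A beta) (Q A beta) (m + k) ->
  exists s : 'rV[R]_k -> 'cV[R]_m * 'cV[R]_n, continuous s /\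
    forall z, saddle A beta (z - (s z).2^T *m beta_mx beta) (s z).1 (s z).2.
Proof.
move=> m0 n0 hP hQ; set B := beta_mx beta.
have /choice[s sP] : forall z : 'rV[R]_k, exists xy : 'cV[R]_m * 'cV[R]_n,
    saddle A beta (z - xy.2^T *m B) xy.1 xy.2.
  move=> z; have [x [y xy]] := saddle_exists A beta z m0 n0.
  by exists (x, y).
exists s; split=> // z.
have compactK := compact_setX (@simplex_compact R m) (@simplex_compact R n).
have s_simplex w : (simplex R m `*` simplex R n) (s w).
  by have [? ? _ _] := sP w.
have FF : ProperFilter (s w @[w --> z]) := fmap_proper_filter s (nbhs_pfilter z).
apply: (compact_unique_cluster_cvg (FF := FF) compactK).
  exact: (filterS (F := nbhs z) (fun w _ => s_simplex w) filterT).
move=> [x y] [/= xS yS] cl.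
have xy_saddle : saddle A beta (z - y^T *m B) x y.
  pose T : topologicalType := ('rV[R]_k * ('cV[R]_m * 'cV[R]_n))%type.
  have idc : continuous (fun t : T => t) by exact: id_continuous.
  have zc : continuous (fun t : T => t.1) by exact: continuous_fst idc.
  have xc : continuous (fun t : T => t.2.1).
    exact: continuous_fst (continuous_snd idc).
  have yc : continuous (fun t : T => t.2.2).
    exact: continuous_snd (continuous_snd idc).
  have payc (f : T -> 'cV[R]_m) (g : T -> 'cV[R]_n) : continuous f -> continuous g ->
      continuous (fun t : T => payoff A (f t) (g t)).
    move=> fc gc; apply: continuous_coord; apply: continuous_mulmx => //.
    apply: continuous_mulmx; last exact: cst_continuous.
    exact: continuous_trmx.
  have yBc (g : T -> 'cV[R]_n) : continuous g -> continuous (fun t : T => (g t)^T *m B).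
    move=> gc; apply: continuous_mulmx; last exact: cst_continuous.
    exact: continuous_trmx.
  have dotc (g : T -> 'cV[R]_n) : continuous g ->
      continuous (fun t : T => dot (t.1 - t.2.2^T *m B) ((g t)^T *m B)).
    move=> gc; apply: continuous_coord; apply: continuous_mulmx.
      by apply: continuous_subf => //; exact: yBc.
    by apply: continuous_trmx; exact: yBc.
  split=> // [x' x'S|y' y'S]; rewrite -subr_ge0.
    pose phi (t : T) := payoff A t.2.1 t.2.2 - payoff A x' t.2.2.
    apply: (cluster_ge0 (phi := phi) _ _ cl) => [|w].
      apply: continuous_subf; apply: payc => //; exact: cst_continuous.
    by have [_ _ /(_ _ x'S) + _] := sP w; rewrite -subr_ge0.
  pose phi (t : T) := payoff A t.2.1 y' - dot (t.1 - t.2.2^T *m B) (y'^T *m B)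
    - (payoff A t.2.1 t.2.2 - dot (t.1 - t.2.2^T *m B) (t.2.2^T *m B)).
  apply: (cluster_ge0 (phi := phi) _ _ cl) => [|w].
    apply: continuous_subf; apply: continuous_subf; try exact: dotc;
      try (by apply: payc => //; exact: cst_continuous).
    by apply: dotc; exact: cst_continuous.
  by have [_ _ _ /(_ _ y'S)] := sP w; rewrite -subr_ge0.
have [|-> ->] := saddle_unique hP hQ xy_saddle (sP z); first by rewrite !subrK.
by rewrite -surjective_pairing.
Qed.

(** * The homeomorphism *)

(** Full row rank lets [pinvmx] cancel the factor [B^T], so that [alpha] is recovered continuously
    from the game. *)
Lemma row_free_beta (R : realType) (n k : nat) (beta : k.-tuple 'cV[R]_n) :
  free beta -> row_free (beta_mx beta)^T.
Proof.
move=> /freeP beta_free; rewrite -kermx_eq0; apply/rowV0P => v /sub_kermxP vB.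
apply/rowP => l; rewrite mxE; apply: (beta_free (fun l => v 0 l)).
apply/colP => j; have /rowP/(_ j) := vB; rewrite !mxE => vBj.
rewrite summxE -[RHS]vBj; apply: eq_bigr => i _.
by rewrite !mxE (tnth_nth 0).
Qed.

Unset Implicit Arguments.

Theorem theorem20 (R : realType) (m n k : nat) (hm : (0 < m)%N) (hn : (0 < n)%N)
    (A : 'M[R]_(m, n)) (beta : k.-tuple 'cV[R]_n)
    (hbeta : free beta)
    (hP : nondegenerate_polyhedron (P_ineq A) (P A) n)
    (hQ : nondegenerate_polyhedron (Q_ineq A beta) (Q A beta) (m + k)) :
  (exists param : 'M[R]_(m, n) * 'M[R]_(m, n) -> 'M[R]_(m, k),
     homeomorphism_between setT (game_space A beta) (game A beta) param) /\
  homeomorphic (nash_correspondence A beta) (game_space A beta).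
Proof.
pose B := beta_mx beta.
pose param (G : 'M[R]_(m, n) * 'M[R]_(m, n)) : 'M[R]_(m, k) :=
  (G.2 + A) *m pinvmx B^T.
have gameK alpha : param (game A beta alpha) = alpha.
  by rewrite /param gameE /= addrAC addNr add0r mulmxKp // row_free_beta.
have paramc : continuous param.
  apply: continuous_mulmx; last exact: cst_continuous.
  apply: continuous_addf; last exact: cst_continuous.
  by apply: continuous_snd; exact: id_continuous.
have gamec : continuous (game A beta).
  rewrite (_ : game A beta = fun alpha => (A, - A + alpha *m B^T)).
    apply: continuous_pair; first exact: cst_continuous.
    apply: continuous_addf; first exact: cst_continuous.
    by apply: continuous_mulmx; [exact: id_continuous|exact: cst_continuous].
  by apply/funext => alpha; rewrite gameE.
split.
  exists param; split; try exact: continuous_subspaceT.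
    by split=> // alpha _; exists alpha.
  by split=> // G [alpha _ <-]; rewrite gameK.
have [s [sc sP]] := saddle_selection hm hn hP hQ.
pose i0 := Ordinal hm.
pose one : 'cV[R]_m := const_mx 1.
have row_one i (z : 'rV[R]_k) : row i (one *m z) = z.
  by apply/rowP => l; rewrite !mxE big_ord1 mxE mul1r.
have simplex_one (x : 'cV[R]_m) (z : 'rV[R]_k) : simplex R m x ->
    x^T *m (one *m z) = z.
  move=> [_ x1]; rewrite mulmxA (_ : x^T *m one = 1%:M) ?mul1mx //.
  apply/matrixP => i j; rewrite !ord1 !mxE -x1.
  by apply: eq_bigr => l _; rewrite !mxE mulr1.
have cancel (u v : 'rV[R]_k) : u + (v - (v + u)) = 0.
  by rewrite opprD [v + _]addrA subrr add0r subrr.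
(* [shift] adds a multiple of the all-ones vector to each alpha^l so that row
   [i0] becomes z; [unshift] moves back by the amount that makes
   [x^T alpha = z - y^T B]. *)
pose shift (t : 'M[R]_(m, k) * 'cV[R]_m * 'cV[R]_n) : 'M[R]_(m, k) :=
  t.1.1 + one *m (t.1.2^T *m t.1.1 + t.2^T *m B - row i0 t.1.1).
pose unshift (a : 'M[R]_(m, k)) : 'M[R]_(m, k) * 'cV[R]_m * 'cV[R]_n :=
  let: (x, y) := s (row i0 a) in
  (a + one *m (row i0 a - y^T *m B - x^T *m a), x, y).
have unshift_saddle a (t := unshift a) : t.1.2^T *m t.1.1 = row i0 a - t.2^T *m B.
  rewrite /t /unshift; have := sP (row i0 a).
  case: (s _) => x y /= [xS _ _ _].
  rewrite (mulmxDr x^T) simplex_one //.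
  by rewrite addrC subrK.
have shiftK t : nash_correspondence A beta t -> unshift (shift t) = t.
  case: t => [[alpha x] y] /nash_saddle xy.
  (* Row [i0] of the shifted parameter is the coordinate [z] of [(x, y)], so by uniqueness [s]
     returns [(x, y)] there. *)
  have row0 : row i0 (shift (alpha, x, y)) = x^T *m alpha + y^T *m B.
    by rewrite /shift /= linearD /= row_one addrC subrK.
  rewrite /unshift row0; have := sP (x^T *m alpha + y^T *m B).
  case: (s _) => x' y' /= x'y'.
  have [|<- <-] := saddle_unique hP hQ xy x'y'; first by rewrite subrK.
  congr (_, _, _); rewrite addrK /shift /= (mulmxDr x^T) simplex_one; last by case: xy.
  by rewrite -addrA -mulmxDr cancel mulmx0 addr0.
(* By [unshift_saddle], the coordinate [z] of [unshift a] is row [i0] of [a], so [shift] restores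
   that row and undoes the multiple of [one]. *)
have unshiftK a : shift (unshift a) = a.
  rewrite /shift unshift_saddle subrK /unshift; case: (s _) => x y /=.
  by rewrite [row i0 (_ + _)]linearD /= row_one -addrA -mulmxDr cancel mulmx0 addr0.
have unshift_nash a : nash_correspondence A beta (unshift a).
  have := unshift_saddle a; have := sP (row i0 a).
  rewrite /unshift; case: (s _) => x y /= xy sadE.
  by apply/nash_saddle; rewrite sadE.
have shiftc : continuous shift.
  pose T : topologicalType := ('M[R]_(m, k) * 'cV[R]_m * 'cV[R]_n)%type.
  have idc : continuous (fun t : T => t) by exact: id_continuous.
  have ac : continuous (fun t : T => t.1.1).
    exact: continuous_fst (continuous_fst idc).
  have xc : continuous (fun t : T => t.1.2).
    exact: continuous_snd (continuous_fst idc).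
  have yc : continuous (fun t : T => t.2) by exact: continuous_snd idc.
  apply: continuous_addf => //; apply: continuous_mulmx.
    exact: cst_continuous.
  apply: continuous_subf; last first.
    apply: continuous_mx => i j; under eq_fun do rewrite mxE.
    exact: continuous_coord.
  apply: continuous_addf; apply: continuous_mulmx => //.
  - exact: continuous_trmx.
  - exact: continuous_trmx.
  - exact: cst_continuous.
have unshiftc : continuous unshift.
  have r0c : continuous (row i0 : 'M[R]_(m, k) -> 'rV[R]_k).
    apply: continuous_mx => i j; under eq_fun do rewrite mxE.
    by apply: continuous_coord; exact: id_continuous.
  have srow : continuous (fun a : 'M[R]_(m, k) => s (row i0 a)).
    exact: continuous_compf r0c sc.
  have xc : continuous (fun a : 'M[R]_(m, k) => (s (row i0 a)).1).
    exact: continuous_fst srow.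
  have yc : continuous (fun a : 'M[R]_(m, k) => (s (row i0 a)).2).
    exact: continuous_snd srow.
  have -> : unshift = fun a => (a + one *m (row i0 a - (s (row i0 a)).2^T *m B
      - (s (row i0 a)).1^T *m a), (s (row i0 a)).1, (s (row i0 a)).2).
    by apply/funext => a; rewrite /unshift; case: (s _).
  apply: continuous_pair => //; apply: continuous_pair => //.
  apply: continuous_addf; first exact: id_continuous.
  apply: continuous_mulmx; first exact: cst_continuous.
  apply: continuous_subf; last first.
    by apply: continuous_mulmx; [exact: continuous_trmx|exact: id_continuous].
  apply: continuous_subf => //; apply: continuous_mulmx.
    exact: continuous_trmx.
  exact: cst_continuous.
exists (game A beta \o shift), (unshift \o param); split.
- split=> [t _|G _]; first by exists (shift t).
  exact: unshift_nash.
- split=> [t Et|G [alpha _ <-]] /=; first by rewrite gameK shiftK.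
  by rewrite gameK unshiftK.
- by apply: continuous_subspaceT; exact: continuous_compf shiftc gamec.
by apply: continuous_subspaceT; exact: continuous_compf paramc unshiftc.
Qed.
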